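(* The bracket pair of the tangle $T_{20}$ modulo $2$ is $\begin{bmatrix}1\\0\end{bmatrix}$, that is, $f(T_{20})\equiv 1 \mod 2$ and $g(T_{20})\equiv 0\mod 2$. Moreover, the leading term of $f(T_{20})$ is $2\,t^{28}$ and that of $g(T_{20})$ is $2\,t^{26}$.
   Context: Tangles. A tangle is a tangle diagram in a disc with four boundary endpoints NW, NE, SW, SE. $T_1+T_2$ (horizontal sum) places $T_1$ to the left of $T_2$, joining the NE and SE endpoints of $T_1$ to the NW and SW endpoints of $T_2$ respectively. $T_1\ast T_2$ (vertical sum) places $T_1$ above $T_2$, joining the SW and SE endpoints of $T_1$ to the NW and NE endpoints of $T_2$ respectively. The tangle $0$ consists of two disjoint arcs joining NW to NE and SW to SE; the tangle $\infty$ consists of two disjoint arcs joining NW to SW and NE to SE. The tangle $1$ is a single crossing whose overstrand joins NW to SE and whose understrand joins SW to NE; the tangle $-1$ is a single crossing whose overstrand joins SW to NE and whose understrand joins NW to SE. For a tangle $T$, $-T$ is obtained from $T$ by switching all crossings. For a positive integer $k$: $k=1+\cdots+1$, $-k=(-1)+\cdots+(-1)$, $1/k=1\ast\cdots\ast 1$ and $-1/k=(-1)\ast\cdots\ast(-1)$, with $k$ terms each. Define $T_{10}=((((1/2)+1)\ast 2)+(-3))\ast 2$ and $T_{20}=T_{10}+(-T_{10})$. Kauffman bracket pair. Let $\Lambda=\mathbb{Z}[t,t^{-1}]$ and $\delta=-t^{-2}-t^2$. The Kauffman bracket of a tangle is computed by the rules: $\langle \bigcirc\rangle=1$ for a single crossingless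 circle; $\langle\bigcirc\amalg T\rangle=\delta\langle T\rangle$; and, locally at a crossing, $\langle -1\rangle=t^{-1}\langle 0\rangle+t\langle\infty\rangle$ (hence $\langle 1\rangle=t\langle 0\rangle+t^{-1}\langle\infty\rangle$). For a tangle $T$ this yields a unique expression $\langle T\rangle=f(T)\langle 0\rangle+g(T)\langle\infty\rangle$ with $f(T),g(T)\in\Lambda$; the bracket pair of $T$ is $\begin{bmatrix}f(T)\\ g(T)\end{bmatrix}\in\Lambda^2$. For $f,g\in\Lambda$ and an integer $m\ge 2$, $f\equiv g\mod m$ means $f-g\in m\Lambda$. The leading term of a nonzero Laurent polynomial is its term of highest degree in $t$ (coefficient included). *)

(* Defs.v *)
From HB Require Import structures.
From mathcomp Require Import all_boot all_order all_algebra.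
From mathcomp Require Import finmap.
From mathcomp.multinomials Require Import monalg.

Set Implicit Arguments.
Unset Strict Implicit.
Unset Printing Implicit Defensive.

Import Order.TTheory GRing.Theory Num.Theory.

Local Open Scope ring_scope.

(* The ring Z[t, t^-1].  As an additive group it is {malg int[int]}, finitely *)
(* supported functions from exponents to coefficients.  The library puts a    *)
(* product on {malg R[K]} only when K is a monomType, which excludes groups,  *)
(* so the convolution product is set up here on an alias.                     *)
Definition laurent : Type := {malg int[int]}.

HB.instance Definition _ := GRing.Zmodule.on laurent.

Implicit Types f g h : laurent.

Definition tpow (n : int) : laurent := << 1 *g n >>.

(* Locked because unification in lmodules over laurent otherwise unfolds it. *)
HB.lock Definition laurent_mul (f g : laurent) : laurent :=
  \sum_(i <- msupp f) \sum_(j <- msupp g) << f@_i * g@_j *g (i + j)%R >>.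

Section LaurentRing.
Local Open Scope fset_scope.

Lemma laurent_mulw (d1 d2 : {fset int}) f g :
  msupp f `<=` d1 -> msupp g `<=` d2 ->
  laurent_mul f g =
  \sum_(i <- d1) \sum_(j <- d2) << f@_i * g@_j *g (i + j)%R >>.
Proof.
move=> le_d1 le_d2; rewrite unlock (big_fset_incl _ le_d1) /=.
  apply/eq_bigr=> i _; apply/big_fset_incl => // j _ /mcoeff_outdom ->.
  by rewrite mulr0 monalgU0.
move=> i _ /mcoeff_outdom fi.
by rewrite big1 => // j _; rewrite fi mul0r monalgU0.
Qed.

Lemma laurent_mulC : commutative laurent_mul.
Proof.
move=> f g; rewrite unlock exchange_big.
apply/eq_bigr=> i _; apply/eq_bigr=> j _.
by rewrite mulrC addrC.
Qed.

Lemma laurent_mul0 : left_zero 0 laurent_mul.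
Proof. by move=> f; rewrite unlock msupp0 big_seq_fset0. Qed.

Lemma laurent_mulUU (c d i j : int) :
  laurent_mul << c *g i >> << d *g j >> = << c * d *g (i + j)%R >>.
Proof.
rewrite (laurent_mulw msuppU_le msuppU_le) big_seq_fset1 big_seq_fset1.
by rewrite !mcoeffUU.
Qed.

Lemma laurent_mulDl : left_distributive laurent_mul +%R.
Proof.
move=> f g h.
rewrite [in RHS](laurent_mulw (fsubsetUl _ (msupp g)) (fsubset_refl _)).
rewrite [in RHS](laurent_mulw (fsubsetUr (msupp f) _) (fsubset_refl _)).
rewrite (laurent_mulw (msuppD_le _ _) (fsubset_refl _)).
rewrite -big_split /=; apply/eq_bigr=> i _.
rewrite -big_split /=; apply/eq_bigr=> j _.
by rewrite mcoeffD mulrDl monalgUD.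
Qed.

Lemma laurent_mulDr : right_distributive laurent_mul +%R.
Proof. by move=> f g h; rewrite !(laurent_mulC f) laurent_mulDl. Qed.

Lemma laurent_mul_suml I (r : seq I) (F : I -> laurent) g :
  laurent_mul (\sum_(i <- r) F i) g = \sum_(i <- r) laurent_mul (F i) g.
Proof.
exact: (big_morph (laurent_mul^~ g) (fun _ _ => laurent_mulDl _ _ _)
                  (laurent_mul0 g)).
Qed.

Lemma laurent_mul_sumr I (r : seq I) (F : I -> laurent) g :
  laurent_mul g (\sum_(i <- r) F i) = \sum_(i <- r) laurent_mul g (F i).
Proof.
rewrite laurent_mulC laurent_mul_suml.
by apply/eq_bigr=> i _; rewrite laurent_mulC.
Qed.

Lemma laurentE f : f = \sum_(i <- msupp f) << f@_i *g i >>.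
Proof. exact: monalgE. Qed.

Lemma laurent_mulEl f g :
  laurent_mul f g = \sum_(i <- msupp f) laurent_mul << f@_i *g i >> g.
Proof. by rewrite {1}(laurentE f) laurent_mul_suml. Qed.

Lemma laurent_mulEr f g :
  laurent_mul f g = \sum_(j <- msupp g) laurent_mul f << g@_j *g j >>.
Proof. by rewrite {1}(laurentE g) laurent_mul_sumr. Qed.

Lemma laurent_mulA : associative laurent_mul.
Proof.
move=> f g h.
rewrite (laurent_mulEl f (laurent_mul g h)) (laurent_mulEl f g).
rewrite (laurent_mul_suml _ _ h); apply/eq_bigr=> i _.
rewrite (laurent_mulEl g h) (laurent_mulEr _ g).
rewrite (laurent_mul_suml _ _ h) laurent_mul_sumr; apply/eq_bigr=> j _.
rewrite (laurent_mulEr _ h) laurent_mul_sumr (laurent_mulEr _ h).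
by apply/eq_bigr=> k _; rewrite !laurent_mulUU mulrA addrA.
Qed.

Lemma laurent_mul1 : left_id (tpow 0) laurent_mul.
Proof.
move=> f; rewrite [in LHS](laurentE f) laurent_mul_sumr [RHS]laurentE.
by apply/eq_bigr=> i _; rewrite laurent_mulUU mul1r add0r.
Qed.

Lemma laurent_1neq0 : tpow 0 != 0.
Proof. by rewrite monalgU_eq0. Qed.

HB.instance Definition _ := GRing.Zmodule_isComNzRing.Build laurent
  laurent_mulA laurent_mulC laurent_mul1 laurent_mulDl laurent_1neq0.

End LaurentRing.

Definition delta : laurent := - tpow (- 2) - tpow 2.

Definition congr_mod (m : nat) f g : Prop := exists h, f - g = h *+ m.

(* The leading term of f is c t^n. *)
Definition leading_term f (c n : int) : Prop :=
  [/\ c != 0, f@_n = c & forall k : int, n < k -> f@_k = 0].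

(* A diagram in general position with respect to the height function is cut   *)
(* by horizontal lines into pieces, listed from top to bottom.  Strands       *)
(* meeting a horizontal line are numbered from the left, starting from 0.     *)
(* Open i is a local maximum, its two legs becoming strands i and i.+1;       *)
(* Close i is a local minimum joining strands i and i.+1; Cross s i crosses   *)
(* strands i and i.+1, the overstrand running from upper left to lower right  *)
(* if s is true, and from lower left to upper right if s is false.            *)
Inductive piece := Open of nat | Close of nat | Cross of bool & nat.

Definition piece_width (n : nat) (p : piece) : option nat :=
  match p with
  | Open i => if (i <= n)%N then Some n.+2 else None
  | Close i => if (i.+1 < n)%N then Some n.-2 else None
  | Cross _ i => if (i.+1 < n)%N then Some n else None
  end.

(* The number of strands at the bottom of w, when there are n at the top. *)
Fixpoint width (n : nat) (w : seq piece) : option nat :=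
  if w is p :: w' then obind (width^~ w') (piece_width n p) else Some n.

(* The strands at the top end at NW and NE, those at the bottom at SW and SE. *)
Record tangle := Tangle {
  pieces :> seq piece;
  tangle_width : width 2 pieces == Some 2 }.

Definition shift_piece (k : nat) (p : piece) : piece :=
  match p with
  | Open i => Open (k + i)
  | Close i => Close (k + i)
  | Cross s i => Cross s (k + i)
  end.

Definition switch_piece (p : piece) : piece :=
  if p is Cross s i then Cross (~~ s) i else p.

Section Width.
Local Open Scope nat_scope.

Lemma width_cat n u v : width n (u ++ v) = obind (width^~ v) (width n u).
Proof.
by elim: u n => //= p u IHu n; case: (piece_width n p) => //= m; apply: IHu.
Qed.

Lemma width_shift k n m w :
  width n w = Some m -> width (k + n) (map (shift_piece k) w) = Some (k + m).
Proof.
elim: w n => [|p w IHw] n /= => [[->] //|].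
case: p => [i|i|s i] /=; case: ifP => //= lt_in.
- by rewrite leq_add2l lt_in => /IHw; rewrite !addnS.
- rewrite -addnS ltn_add2l lt_in => /IHw.
  by case: n lt_in => [|[|n]] // _; rewrite !addnS.
- by rewrite -addnS ltn_add2l lt_in => /IHw.
Qed.

Lemma width_widen k n m w :
  width n w = Some m -> width (n + k) w = Some (m + k).
Proof.
elim: w n => [|p w IHw] n /= => [[->] //|].
case: p => [i|i|s i] /=; case: ifP => //= lt_in.
- by rewrite (leq_trans lt_in (leq_addr k n)) => /IHw.
- rewrite (leq_trans lt_in (leq_addr k n)) => /IHw.
  by case: n lt_in => [|[|n]].
- by rewrite (leq_trans lt_in (leq_addr k n)) => /IHw.
Qed.

Lemma width_switch n w : width n (map switch_piece w) = width n w.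
Proof.
elim: w n => //= p w IHw n; case: p => [i|i|s i] /=; case: ifP => //= _.
Qed.

End Width.

Definition zero_pieces := [:: Close 0; Open 0].
Definition hsum_pieces (u v : seq piece) :=
  Open 1 :: u ++ map (shift_piece 2) v ++ [:: Close 1].

Fact infty_subproof : width 2 [::] == Some 2. Proof. by []. Qed.
Fact zero_subproof : width 2 zero_pieces == Some 2. Proof. by []. Qed.
Fact cross_subproof s : width 2 [:: Cross s 0] == Some 2. Proof. by []. Qed.
Fact hsum_subproof (T1 T2 : tangle) : width 2 (hsum_pieces T1 T2) == Some 2.
Proof.
case: T1 T2 => [u /eqP uP] [v /eqP vP] /=; rewrite width_cat.
by rewrite (width_widen 2 uP) /= width_cat (width_shift 2 vP).
Qed.
Fact vsum_subproof (T1 T2 : tangle) : width 2 (T1 ++ T2) == Some 2.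
Proof. by case: T1 T2 => [u /eqP uP] [v vP] /=; rewrite width_cat uP. Qed.
Fact switch_subproof (T : tangle) : width 2 (map switch_piece T) == Some 2.
Proof. by rewrite width_switch tangle_width. Qed.

Definition tangle_infty := Tangle infty_subproof.
Definition tangle_zero := Tangle zero_subproof.
Definition tangle_one := Tangle (cross_subproof true).
Definition tangle_mone := Tangle (cross_subproof false).

(* T1 + T2: the new local maximum joins NE of T1 to NW of T2, and the new     *)
(* local minimum joins SE of T1 to SW of T2.                                  *)
Definition hsum (T1 T2 : tangle) := Tangle (hsum_subproof T1 T2).
(* T1 * T2, with T1 above T2. *)
Definition vsum (T1 T2 : tangle) := Tangle (vsum_subproof T1 T2).
Definition switch (T : tangle) := Tangle (switch_subproof T).

(* The tangles k, -k and 1/k, for k > 0. *)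
Definition tangle_pos (k : nat) := iterop k hsum tangle_one tangle_zero.
Definition tangle_neg (k : nat) := iterop k hsum tangle_mone tangle_zero.
Definition tangle_inv (k : nat) := iterop k vsum tangle_one tangle_infty.

Definition T10 : tangle :=
  vsum (hsum (vsum (hsum (tangle_inv 2) tangle_one) (tangle_pos 2))
             (tangle_neg 3))
       (tangle_pos 2).

Definition T20 : tangle := hsum T10 (switch T10).

(* Tracing a crossingless diagram from top to bottom: the number of circles   *)
(* completed so far, and, for NW, NE and each strand at the current level, a  *)
(* label of the component it belongs to.                                      *)
Record trace_state := TraceState {
  circles : nat; nw : nat; ne : nat; front : seq nat }.

Definition trace_start := TraceState 0 0 1 [:: 0%N; 1%N].

(* The crossing case is never used: crossings are smoothed before tracing. *)
Definition trace_step (s : trace_state) (p : piece) : trace_state :=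
  let: TraceState c a b l := s in
  match p with
  | Open i =>
      let x := (foldr maxn 0 [:: a, b & l]).+1 in
      TraceState c a b (take i l ++ [:: x; x] ++ drop i l)
  | Close i =>
      let x := nth 0%N l i in
      let y := nth 0%N l i.+1 in
      let l' := take i l ++ drop i.+2 l in
      if x == y then TraceState c.+1 a b l'
      else let r z := if z == y then x else z in
           TraceState c (r a) (r b) (map r l')
  | Cross _ _ => s
  end.

Definition bracket_zero : 'cV[laurent]_2 := delta_mx 0 0.
Definition bracket_infty : 'cV[laurent]_2 := delta_mx 1 0.

(* In a crossingless planar diagram NW is joined either to NE, as in the      *)
(* tangle 0, or to SW, as in the tangle infinity.                             *)
Definition crossingless_bracket (w : seq piece) : 'cV[laurent]_2 :=
  let s := foldl trace_step trace_start w in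
  delta ^+ circles s *:
    (if nw s == ne s then bracket_zero else bracket_infty).

(* The bracket of u ++ w, where u has no crossing. *)
Fixpoint bracket_rec (u w : seq piece) : 'cV[laurent]_2 :=
  match w with
  | [::] => crossingless_bracket u
  | Cross s i :: w' =>
      tpow (if s then 1 else -1) *: bracket_rec (u ++ [:: Close i; Open i]) w'
      + tpow (if s then -1 else 1) *: bracket_rec u w'
  | p :: w' => bracket_rec (rcons u p) w'
  end.

Definition bracket_pair (T : tangle) : 'cV[laurent]_2 := bracket_rec [::] T.

Definition bracket_f (T : tangle) : laurent := bracket_pair T 0 0.
Definition bracket_g (T : tangle) : laurent := bracket_pair T 1 0.

Lemma tpowD (m n : int) : tpow m * tpow n = tpow (m + n).
Proof. by rewrite [LHS]laurent_mulUU mulr1. Qed.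

(* The local rule holds at every crossing, not only at the topmost one. *)
Lemma bracket_skein u s i v w : bracket_rec u (v ++ Cross s i :: w) =
  tpow (if s then 1 else -1) *: bracket_rec u (v ++ [:: Close i; Open i] ++ w)
  + tpow (if s then -1 else 1) *: bracket_rec u (v ++ w).
Proof.
elim: v u => [|p v IHv] u /=; first by rewrite -!cats1 -catA.
case: p => [j|j|s' j]; [exact: IHv | exact: IHv | rewrite (IHv u) IHv].
move: (tpow (if s' then 1 else _)) (tpow (if s' then _ else 1)) => a b.
move: (tpow (if s then 1 else _)) (tpow (if s then _ else 1)) => c d.
do 4!move: (bracket_rec _ _) => ?.
rewrite !scalerDr !scalerA addrACA.
by rewrite (mulrC a c) (mulrC b c) (mulrC a d) (mulrC b d).
Qed.

(* Main.v *)
Require Import Defs.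
From mathcomp Require Import all_boot all_order all_algebra.
From mathcomp Require Import zify ring.
From mathcomp.multinomials Require Import monalg.

Set Implicit Arguments.
Unset Strict Implicit.
Unset Printing Implicit Defensive.

Import Order.TTheory GRing.Theory Num.Theory.
Local Open Scope ring_scope.

(** The bracket pair is multiplicative enough to be computed tangle by tangle.
By the skein rule the bracket is linear in the tangle, so if a tangle could be
replaced, inside any larger diagram, by f times the tangle 0 plus g times the
tangle infinity, then evaluating the four diagrams obtained from 0 and infinity
would give
  f (T1 + T2) = f1 f2,  g (T1 + T2) = f1 g2 + g1 f2 + delta g1 g2,
and the same with f and g exchanged for the vertical sum.  These formulas,
[bracket_hsum] and [bracket_vsum], replace the 2 ^ 20 states of T20 by nine
steps with short Laurent polynomials.

The substance is the replacement principle [bracket_from_tangle], because the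
bracket is defined by tracing strand labels through a whole diagram, and
nothing in that definition is local.  Three facts make it local.  The trace
only matters up to an injective renaming of labels ([bracket_from_same]).  Up
to renaming, a maximum followed by a minimum obeys the Temperley-Lieb
relations: it is a circle, or a zigzag that can be straightened, or the two
commute.  These relations push all minima of a crossingless diagram above all
its maxima, and the only diagrams of this shape with two strands at the top and
two at the bottom are the tangles 0 and infinity ([reduce_tangle]).  In
particular the crossed pairing of the four endpoints, which labels alone would
permit, does not occur.

For the computation, T10 and its mirror image are treated together: switching
crossings exchanges t and t ^ -1, so a boolean b selects which of the two is
called t ([bracket_T10]).  Multiplying out, f (T20) is 1 + 2 F and g (T20) is
2 G with F and G explicit and led by t ^ 28 and t ^ 26; the congruences modulo
2 and the leading terms can be read off. *)

(** * Tracing up to renaming of labels *)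

Section Trace.
Local Open Scope nat_scope.

Implicit Types (s : trace_state) (p : piece) (u v w : seq piece).

Definition labels s := [:: nw s, ne s & front s].

Definition relabel (phi : nat -> nat) s :=
  TraceState (circles s) (phi (nw s)) (phi (ne s)) (map phi (front s)).

Definition same_joins s s' :=
  exists2 phi : nat -> nat,
    {in labels s &, injective phi} & s' = relabel phi s.

Definition fresh s := (foldr maxn 0 (labels s)).+1.

(** The renaming performed by a minimum that joins two components. *)
Definition join_label (x y z : nat) := if z == y then x else z.

Lemma fresh_notin s : fresh s \notin labels s.
Proof.
have le_fold l z : z \in l -> z <= foldr maxn 0 l.
  elim: l => //= y l IHl; rewrite inE leq_max => /orP[/eqP->|/IHl ->].
    by rewrite leqnn.
  by rewrite orbT.
by apply/negP => /le_fold; rewrite ltnn.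
Qed.

Lemma labels_relabel phi s : labels (relabel phi s) = map phi (labels s).
Proof. by []. Qed.

Lemma eq_in_relabel phi psi s :
  {in labels s, phi =1 psi} -> relabel phi s = relabel psi s.
Proof.
move=> eq_phi; rewrite /relabel !eq_phi ?inE ?eqxx ?orbT //; congr TraceState.
by apply/eq_in_map => z l_z; apply: eq_phi; rewrite !inE l_z !orbT.
Qed.

Lemma relabel_id s : relabel id s = s.
Proof. by case: s => c a b l; rewrite /relabel map_id. Qed.

(** All later arguments use only that the label of a new maximum is new, never
which label it is. *)
Lemma trace_open c a b l1 l2 :
  exists2 x, x \notin [:: a, b & l1 ++ l2] &
    trace_step (TraceState c a b (l1 ++ l2)) (Open (size l1)) =
    TraceState c a b (l1 ++ [:: x, x & l2]).
Proof.
exists (fresh (TraceState c a b (l1 ++ l2))).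
  exact: (fresh_notin (TraceState c a b (l1 ++ l2))).
by rewrite /= take_size_cat // drop_size_cat.
Qed.

(** The state after a minimum joins strands labelled [x] and [y], where [l]
lists the strands that remain. *)
Definition close_up c a b l x y :=
  if x == y then TraceState c.+1 a b l
  else relabel (join_label x y) (TraceState c a b l).

Lemma trace_close c a b l1 x y l2 :
  trace_step (TraceState c a b (l1 ++ [:: x, y & l2])) (Close (size l1)) =
  close_up c a b (l1 ++ l2) x y.
Proof.
rewrite /= take_size_cat // -cat_rcons -[in drop _ _]cat_rcons.
rewrite drop_size_cat ?size_rcons //.
rewrite cat_rcons !nth_cat ltnn subnn ltnNge leqnSn subSnn /= /close_up.
by case: eqP.
Qed.

Lemma split_at (l : seq nat) i : i <= size l ->
  exists l1 l2, l = l1 ++ l2 /\ size l1 = i.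
Proof.
move=> le_il; exists (take i l), (drop i l).
by rewrite cat_take_drop size_takel.
Qed.

Lemma split_at2 (l : seq nat) i : i.+1 < size l ->
  exists l1 x y l2, l = l1 ++ [:: x, y & l2] /\ size l1 = i.
Proof.
move=> lt_il; have [|l1 [l2 [def_l sz_l1]]] := @split_at l i; first by lia.
move: lt_il; rewrite def_l size_cat sz_l1.
case: l2 def_l => [|x [|y l2]] //= _; rewrite ?addn0 ?addn1 ?ltnn //; try lia.
by exists l1, x, y, l2.
Qed.

Definition crossingless p := if p is Cross _ _ then false else true.

Lemma size_front_step s p m : crossingless p ->
  piece_width (size (front s)) p = Some m -> size (front (trace_step s p)) = m.
Proof.
case: s p => c a b l [i|i|] //= _; case: ifP => // lt_il [<-].
  have [l1 [l2 [-> <-]]] := split_at lt_il.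
  by rewrite take_size_cat // drop_size_cat // !size_cat /= !addnS.
have [l1 [x [y [l2 [-> <-]]]]] := split_at2 lt_il.
by rewrite [X in front X]trace_close /close_up; case: ifP => _ /=;
  rewrite ?size_map !size_cat /=; lia.
Qed.

(** A new maximum gets unrelated labels in the two states, so the renaming has
to be redefined there; at a minimum the two merged labels are merged in the
same way on both sides. *)
Lemma same_joins_step s s' p : crossingless p ->
  piece_width (size (front s)) p -> same_joins s s' ->
  same_joins (trace_step s p) (trace_step s' p).
Proof.
move=> nc_p ok_p [phi inj_phi ->] {s'}; case: p nc_p ok_p => [i|i|] // _.
  rewrite /piece_width; case: ifP => // le_il _.
  case: s le_il inj_phi => c a b l; rewrite [front _]/= => le_il.
  have [l1 [l2 [-> <-]]] := split_at le_il => inj_phi.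
  rewrite /relabel [circles _]/= [nw _]/= [ne _]/= [front _]/= map_cat.
  rewrite -[X in same_joins _ (trace_step _ (Open X))](size_map phi).
  have [x l'x ->] := trace_open c a b l1 l2.
  have [y phil'y ->] := trace_open c (phi a) (phi b) (map phi l1) (map phi l2).
  pose psi z := if z == x then y else phi z.
  have psi_x : psi x = y by rewrite /psi eqxx.
  have psiE : {in [:: a, b & l1 ++ l2], psi =1 phi}.
    by move=> z l_z; rewrite /psi; case: eqP => // z_x; rewrite -z_x l_z in l'x.
  have phiN z : z \in [:: a, b & l1 ++ l2] -> phi z <> y.
    move=> l_z phi_z; move: phil'y.
    by rewrite -phi_z -map_cat -!map_cons map_f.
  exists psi; last first.
    rewrite /relabel /= map_cat /= psi_x !psiE ?inE ?eqxx ?orbT //.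
    by congr (TraceState _ _ _ (_ ++ [:: _, _ & _]));
      apply/esym/eq_in_map=> z l_z; apply: psiE; rewrite !inE mem_cat l_z !orbT.
  have sub z : z \in [:: a, b & l1 ++ [:: x, x & l2]] ->
      z = x \/ z \in [:: a, b & l1 ++ l2].
    rewrite !inE !mem_cat !inE.
    by case: (eqVneq z x) => [-> _|_ ?]; [left | right].
  move=> z1 z2 /sub[->|l_z1] /sub[->|l_z2] //; rewrite ?psi_x ?psiE //.
  - by move/esym/phiN.
  - by move/phiN.
  - exact: inj_phi.
rewrite /piece_width; case: ifP => // lt_il _.
case: s lt_il inj_phi => c a b l; rewrite [front _]/= => lt_il.
have [l1 [x [y [l2 [-> <-]]]]] := split_at2 lt_il => inj_phi.
set s := TraceState c a b _.
have -> : relabel phi s = TraceState c (phi a) (phi b)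
   (map phi l1 ++ [:: phi x, phi y & map phi l2]) by rewrite /relabel map_cat.
rewrite -[X in same_joins _ (trace_step _ (Close X))](size_map phi).
rewrite !trace_close /close_up.
have s_x : x \in labels s by rewrite !inE mem_cat !inE eqxx !orbT.
have s_y : y \in labels s by rewrite !inE mem_cat !inE eqxx !orbT.
have sub z : z \in [:: a, b & l1 ++ l2] -> z \in labels s.
  rewrite !inE !mem_cat !inE => /or4P[] -> ; rewrite ?orbT //.
rewrite (inj_in_eq inj_phi) //; case: eqP => [_|/eqP neq_xy].
  exists phi; last by rewrite /relabel /= map_cat.
  by apply: sub_in2 inj_phi => z; apply: sub.
exists phi.
  apply: sub_in2 inj_phi => z; rewrite labels_relabel => /mapP[z' s_z' ->].
  by rewrite /join_label; case: eqP => // _; apply: sub.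
have rE z : z \in [:: a, b & l1 ++ l2] ->
    join_label (phi x) (phi y) (phi z) = phi (join_label x y z).
  by move=> /sub s_z; rewrite /join_label (inj_in_eq inj_phi) //; case: ifP.
rewrite /relabel /= !rE ?inE ?eqxx ?orbT //; congr TraceState.
rewrite -map_cat -!map_comp; apply/eq_in_map => z l_z /=.
by apply: rE; rewrite !inE l_z !orbT.
Qed.

(** A maximum capped off at once is a closed circle. *)
Lemma trace_open_close s i : i <= size (front s) ->
  trace_step (trace_step s (Open i)) (Close i) =
  TraceState (circles s).+1 (nw s) (ne s) (front s).
Proof.
case: s => c a b l; rewrite [front _]/= => /split_at[l1 [l2 [-> <-]]].
by have [x _ ->] := trace_open c a b l1 l2; rewrite trace_close /close_up eqxx.
Qed.

(** Straightening this zigzag renames the straightened strand to the new label,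
which the renaming of the conclusion undoes; in the mirror zigzag the strand
keeps its label, because a minimum keeps the label on its left. *)
Lemma trace_zigzag_right s i : i < size (front s) ->
  same_joins (trace_step (trace_step s (Open i)) (Close i.+1)) s.
Proof.
case: s => c a b l; rewrite [front _]/= => lt_il.
have [l1 [[|y l2] [def_l sz_l1]]] := split_at (ltnW lt_il).
  by move: lt_il; rewrite def_l cats0 sz_l1 ltnn.
rewrite def_l -sz_l1; have [x l'x ->] := trace_open c a b l1 (y :: l2).
set s := TraceState c a b (l1 ++ y :: l2).
have neq_xy : x != y.
  by apply: contraNneq l'x => ->; rewrite !inE mem_cat inE eqxx !orbT.
rewrite -[l1 ++ x :: _]cat_rcons -(size_rcons l1 x).
rewrite trace_close /close_up (negPf neq_xy).
have -> : relabel (join_label x y) (TraceState c a b (rcons l1 x ++ l2)) =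
          relabel (join_label x y) s.
  rewrite /relabel /= !map_cat !map_rcons cat_rcons /=.
  by rewrite /join_label eqxx (negPf neq_xy).
have rK : {in labels s, cancel (join_label x y) (join_label y x)}.
  move=> z s_z; rewrite /join_label; case: (eqVneq z y) => [-> | _].
    by rewrite eqxx.
  by case: eqP => // z_x; rewrite -z_x s_z in l'x.
exists (join_label y x).
  rewrite labels_relabel => _ _ /mapP[z1 s_z1 ->] /mapP[z2 s_z2 ->].
  by rewrite !rK // => ->.
rewrite -[LHS]relabel_id.
rewrite -[LHS](@eq_in_relabel (join_label y x \o join_label x y)).
  by rewrite /relabel /= -map_comp.
exact: rK.
Qed.

Lemma trace_zigzag_left s i : i < size (front s) ->
  trace_step (trace_step s (Open i.+1)) (Close i) = s.
Proof.
case: s => c a b l; rewrite [front _]/= => lt_il.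
have [l1 [[|y l2] [def_l sz_l1]]] := split_at (ltnW lt_il).
  by move: lt_il; rewrite def_l cats0 sz_l1 ltnn.
rewrite def_l -sz_l1 -cat_rcons -(size_rcons l1 y).
have [x l'x ->] := trace_open c a b (rcons l1 y) l2.
have l_y : y \in [:: a, b & rcons l1 y ++ l2].
  by rewrite !inE mem_cat mem_rcons inE eqxx !orbT.
rewrite [_ ++ x :: _]cat_rcons trace_close /close_up; case: eqP => [y_x | _].
  by rewrite -y_x l_y in l'x.
have r_id z : z \in [:: a, b & rcons l1 y ++ l2] -> join_label y x z = z.
  by rewrite /join_label; case: eqP => // -> l_x; rewrite l_x in l'x.
have r_x : join_label y x x = y by rewrite /join_label eqxx.
rewrite -[RHS]relabel_id -(@eq_in_relabel (join_label y x) id) //.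
by rewrite /relabel /= cat_rcons !map_cat /= r_x (r_id y).
Qed.

(** The label of a maximum is immaterial as long as it is new. *)
Lemma same_joins_fresh c a b l1 l2 x y (l := [:: a, b & l1 ++ l2]) :
  x \notin l -> y \notin l ->
  same_joins (TraceState c a b (l1 ++ [:: x, x & l2]))
             (TraceState c a b (l1 ++ [:: y, y & l2])).
Proof.
move=> l'x l'y; pose phi := join_label y x.
have phi_id z : z \in l -> phi z = z.
  move=> l_z; rewrite /phi /join_label; case: eqP => // z_x.
  by rewrite -z_x l_z in l'x.
have phi_x : phi x = y by rewrite /phi /join_label eqxx.
exists phi.
  have sub z : z \in labels (TraceState c a b (l1 ++ [:: x, x & l2])) ->
      z = x \/ z \in l.
    rewrite /l !inE !mem_cat !inE.
    case: (eqVneq z x) => [-> _|_ /=]; first by left.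
    by right.
  move=> z1 z2 /sub[->|l_z1] /sub[->|l_z2] //; rewrite ?phi_x ?phi_id //.
    by move=> y_z; rewrite y_z l_z2 in l'y.
  by move=> y_z; rewrite -y_z l_z1 in l'y.
rewrite /relabel /= map_cat /= phi_x !phi_id ?inE ?eqxx ?orbT //.
by congr (TraceState _ _ _ (_ ++ [:: _, _ & _])); apply/esym/map_id_in => z l_z;
  apply: phi_id; rewrite !inE mem_cat l_z !orbT.
Qed.

(** A minimum and a maximum that share no strand commute: the maximum carries a
label [x] that the minimum does not touch. *)
Lemma close_up_open c a b l1 l2 y z x :
    y != x -> z != x -> x \notin [:: a, b & l1 ++ l2] ->
  same_joins (close_up c a b (l1 ++ [:: x, x & l2]) y z)
    (trace_step (close_up c a b (l1 ++ l2) y z) (Open (size l1))).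
Proof.
move=> y'x z'x l'x; rewrite /close_up; case: ifP => _.
  by have [x' l'x' ->] := trace_open c.+1 a b l1 l2; apply: same_joins_fresh.
set r := join_label y z.
have r_x : r x = x by rewrite /r /join_label eq_sym (negPf z'x).
rewrite /relabel [circles _]/= [nw _]/= [ne _]/= ![front _]/=.
rewrite !map_cat !map_cons r_x.
rewrite -[X in trace_step _ (Open X)](size_map r).
have [x' l'x' ->] := trace_open c (r a) (r b) (map r l1) (map r l2).
apply: same_joins_fresh => //.
rewrite -map_cat (_ : _ :: _ = map r [:: a, b & l1 ++ l2]) //.
apply/mapP=> -[t l_t]; rewrite /r /join_label.
case: ifP => _ x_t; last by rewrite x_t l_t in l'x.
by rewrite x_t eqxx in y'x.
Qed.

Lemma trace_far_left s j d : j + d.+2 <= size (front s) ->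
  same_joins (trace_step (trace_step s (Open (j + d.+2))) (Close j))
             (trace_step (trace_step s (Close j)) (Open (j + d))).
Proof.
case: s => c a b l; rewrite [front _]/= => le_l.
have [|l1 [y [z [l2' [def_l sz_l1]]]]] := @split_at2 l j; first by lia.
have [|l2 [l3 [def_l2' sz_l2]]] := @split_at l2' d.
  by move: le_l; rewrite def_l size_cat /=; lia.
have {le_l def_l l2' def_l2'} -> : l = (l1 ++ [:: y, z & l2]) ++ l3.
  by rewrite def_l def_l2' -catA.
have -> : j + d.+2 = size (l1 ++ [:: y, z & l2]).
  by rewrite -sz_l1 -sz_l2 size_cat.
have [x l'x ->] := trace_open c a b (l1 ++ [:: y, z & l2]) l3.
rewrite -sz_l1 -sz_l2 -!catA !trace_close !catA -size_cat.
apply: close_up_open.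
1,2: by apply: contraNneq l'x => <-; rewrite !inE !mem_cat !inE eqxx !orbT.
apply: contra l'x; rewrite !inE !mem_cat !inE.
by move=> /or3P[->|->|/orP[/orP[]|] ->]; rewrite ?orbT.
Qed.

Lemma trace_far_right s i d : i + d.+1 < size (front s) ->
  same_joins (trace_step (trace_step s (Open i)) (Close (i + d.+2)))
             (trace_step (trace_step s (Close (i + d))) (Open i)).
Proof.
case: s => c a b l; rewrite [front _]/= => lt_l.
have [|l1 [l2' [def_l sz_l1]]] := @split_at l i; first by lia.
have [|l2 [y [z [l3 [def_l2' sz_l2]]]]] := @split_at2 l2' d.
  by move: lt_l; rewrite def_l size_cat; lia.
have {lt_l def_l l2' def_l2'} -> : l = l1 ++ l2 ++ [:: y, z & l3].
  by rewrite def_l def_l2'.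
rewrite -{1 3}sz_l1.
have [x l'x ->] := trace_open c a b l1 (l2 ++ [:: y, z & l3]).
rewrite (_ : i + d.+2 = size (l1 ++ [:: x, x & l2])); last first.
  by rewrite size_cat /= sz_l1 sz_l2.
rewrite -sz_l2 -sz_l1 -size_cat.
have -> : l1 ++ [:: x, x & l2 ++ [:: y, z & l3]] =
          (l1 ++ [:: x, x & l2]) ++ [:: y, z & l3] by rewrite -catA.
rewrite catA !trace_close -!catA.
apply: close_up_open.
1,2: by apply: contraNneq l'x => <-; rewrite !inE !mem_cat !inE eqxx !orbT.
apply: contra l'x; rewrite !inE !mem_cat !inE.
by move=> /or3P[->|->|/or3P[] ->]; rewrite ?orbT.
Qed.

End Trace.

(** * The bracket as a function of the trace state *)

Section BracketFrom.
Implicit Types (s : trace_state) (p : piece) (u v w : seq piece) (k : nat).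

(** The bracket of the diagram whose upper part has been traced to the state
[s] and whose lower part is [w].  Working with states rather than with upper
parts is what lets labels be renamed. *)
Fixpoint bracket_from s w : 'cV[laurent]_2 :=
  match w with
  | [::] => delta ^+ circles s *:
      (if nw s == ne s then bracket_zero else bracket_infty)
  | Cross b i :: w' =>
      tpow (if b then 1 else -1) *:
        bracket_from (foldl trace_step s [:: Close i; Open i]) w'
      + tpow (if b then -1 else 1) *: bracket_from s w'
  | p :: w' => bracket_from (trace_step s p) w'
  end.

Lemma bracket_recE u w :
  bracket_rec u w = bracket_from (foldl trace_step trace_start u) w.
Proof.
elim: w u => //= -[i|i|b i] w IHw u; rewrite !IHw ?foldl_rcons //.
by rewrite foldl_cat.
Qed.

Lemma bracket_from_cat s u w : all crossingless u ->
  bracket_from s (u ++ w) = bracket_from (foldl trace_step s u) w.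
Proof. by elim: u s => //= -[i|i|] // u IHu s /= /IHu->. Qed.

Lemma width_smooth n u b i w :
  width n (u ++ [:: Close i, Open i & w]) = width n (u ++ Cross b i :: w).
Proof.
rewrite !width_cat; case: (width n u) => //= m.
case: ifP => //= lt_im; case: m lt_im => [|[|m]] //=.
by rewrite !ltnS => ->.
Qed.

Lemma width_remove n u b i w : width n (u ++ Cross b i :: w) ->
  width n (u ++ w) = width n (u ++ Cross b i :: w).
Proof. by rewrite !width_cat; case: (width n u) => //= p; case: ifP => //=. Qed.

Lemma width_step s p w : crossingless p ->
  width (size (front s)) (p :: w) ->
  width (size (front (trace_step s p))) w = width (size (front s)) (p :: w).
Proof.
move=> nc_p; rewrite [width _ (_ :: _)]/=.
case def_m: (piece_width _ p) => [m|] //= _.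
by rewrite (size_front_step nc_p def_m).
Qed.

Lemma width_step1 s p w : crossingless p ->
  width (size (front s)) (p :: w) -> piece_width (size (front s)) p.
Proof. by move=> _ /=; case: piece_width. Qed.

(** The bracket looks at labels only through equality tests.  The width
condition matters: at a minimum outside the diagram, tracing would read the
default label 0, which a renaming need not respect. *)
Lemma bracket_from_same s s' w : same_joins s s' ->
  width (size (front s)) w -> bracket_from s w = bracket_from s' w.
Proof.
elim: w s s' => [|p w IHw] s s' ss' ok_w.
  case: ss' => phi inj_phi -> /=; rewrite (inj_in_eq inj_phi) //.
    by rewrite inE eqxx.
  by rewrite !inE eqxx orbT.
have step s1 s2 q v : crossingless q -> same_joins s1 s2 ->
    width (size (front s1)) (q :: v) ->
    same_joins (trace_step s1 q) (trace_step s2 q) /\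
    width (size (front (trace_step s1 q))) v.
  move=> nc_q ss q_v; rewrite width_step //; split=> //.
  by apply: same_joins_step ss => //; apply: width_step1 q_v.
case: p ok_w => [i|i|b i] ok_w.
- by have [ss ok] := step _ _ (Open i) _ isT ss' ok_w; apply: IHw.
- by have [ss ok] := step _ _ (Close i) _ isT ss' ok_w; apply: IHw.
have ok_co := ok_w; rewrite -(width_smooth _ [::]) in ok_co.
have [ss1 ok1] := step _ _ (Close i) _ isT ss' ok_co.
have [ss2 ok2] := step _ _ (Open i) _ isT ss1 ok1.
rewrite /bracket_from -/bracket_from (IHw _ _ ss2 ok2) (IHw s s') //.
by rewrite (width_remove (u := [::]) ok_w).
Qed.

Lemma bracket_from_circle c a b l w :
  bracket_from (TraceState c.+1 a b l) w =
  delta *: bracket_from (TraceState c a b l) w.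
Proof.
have stepS c' a' b' l' p : exists c1 a1 b1 l1,
    trace_step (TraceState c' a' b' l') p = TraceState c1 a1 b1 l1 /\
    trace_step (TraceState c'.+1 a' b' l') p = TraceState c1.+1 a1 b1 l1.
  pose s1 := trace_step (TraceState c' a' b' l') p.
  exists (circles s1), (nw s1), (ne s1), (front s1); rewrite /s1 {s1}.
  by case: p => [i|i|d i] //=; case: ifP.
elim: w c a b l => [|p w IHw] c a b l; first by rewrite /= exprS scalerA.
have [c1 [a1 [b1 [l1 [e1 e2]]]]] := stepS c a b l p.
case: p e1 e2 => [i|i|d i] e1 e2.
- by rewrite /bracket_from -/bracket_from e1 e2.
- by rewrite /bracket_from -/bracket_from e1 e2.
have {e1 e2} [c2 [a2 [b2 [l2 [e1 e2]]]]] := stepS c a b l (Close i).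
have [c3 [a3 [b3 [l3 [e3 e4]]]]] := stepS c2 a2 b2 l2 (Open i).
rewrite /bracket_from -/bracket_from /foldl e1 e2 e3 e4 !IHw.
by rewrite scalerDr !scalerA !(mulrC delta).
Qed.

(** * Straightening crossingless diagrams *)

(** Wherever [w] fits, it may be replaced by [w'] at the cost of [c] circles,
whatever lies above (the state) and below ([v], possibly with crossings). *)
Definition reduces c w w' := forall s,
  width (size (front s)) w ->
  width (size (front s)) w' = width (size (front s)) w /\
  forall v, width (size (front s)) (w ++ v) ->
  bracket_from s (w ++ v) = delta ^+ c *: bracket_from s (w' ++ v).

Lemma reduces_refl w : reduces 0 w w.
Proof. by move=> s _; split=> // v _; rewrite expr0 scale1r. Qed.

Lemma reduces_trans c1 c2 w1 w2 w3 :
  reduces c1 w1 w2 -> reduces c2 w2 w3 -> reduces (c1 + c2) w1 w3.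
Proof.
move=> r12 r23 s ok1; have [w12 e12] := r12 s ok1.
have [|w23 e23] := r23 s; first by rewrite w12.
split=> [|v ok_v]; first by rewrite w23.
by rewrite e12 // e23 ?scalerA -?exprD // width_cat w12 -width_cat.
Qed.

Lemma reduces_cons c p w w' :
  crossingless p -> reduces c w w' -> reduces c (p :: w) (p :: w').
Proof.
move=> nc_p r_ww' s ok_pw; have ok_w := ok_pw; rewrite -width_step // in ok_w.
have [ww' e] := r_ww' _ ok_w; split=> [|v ok_v].
  move: ok_pw ww'; rewrite /=; case def_m: (piece_width _ p) => [m|] //= _.
  by rewrite (size_front_step nc_p def_m).
by case: p nc_p ok_pw ok_w ww' e ok_v => [i|i|] // nc_p ok_pw ok_w ww' e ok_v;
   apply: e; rewrite width_step.
Qed.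

Lemma isSome_width_cat n w v : width n (w ++ v) -> width n w.
Proof. by rewrite width_cat; case: (width n w). Qed.

Lemma reduces_catr v c w w' : reduces c w w' -> reduces c (w ++ v) (w' ++ v).
Proof.
move=> r s ok_wv; have [ww' e] := r s (isSome_width_cat ok_wv).
split=> [|v' ok]; first by rewrite !width_cat ww'.
by rewrite -!catA e // catA.
Qed.
Arguments reduces_catr v {c w w'} _.

Lemma reduces_same p1 p2 w' :
    crossingless p1 -> crossingless p2 -> all crossingless w' ->
    (forall n, width n [:: p1; p2] -> width n w' = width n [:: p1; p2]) ->
    (forall s, width (size (front s)) [:: p1; p2] ->
     same_joins (trace_step (trace_step s p1) p2) (foldl trace_step s w')) ->
  reduces 0 [:: p1; p2] w'.
Proof.
move=> nc1 nc2 nc' ww' ss s ok; split=> [|v ok_v]; first exact: ww'.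
rewrite expr0 scale1r bracket_from_cat /= ?nc1 ?nc2 // bracket_from_cat //.
apply: bracket_from_same; first exact: ss.
by rewrite !width_step // width_step.
Qed.

Lemma reduces_circle i : reduces 1 [:: Open i; Close i] [::].
Proof.
move=> s /=; case: ifP => //= le_i; rewrite !ltnS le_i => _; split=> // v _.
rewrite expr1 trace_open_close // bracket_from_circle.
by case: s {le_i}.
Qed.

Lemma same_joins_refl s : same_joins s s.
Proof. by exists id => //; rewrite relabel_id. Qed.

Lemma reduces_zigzag_right i : reduces 0 [:: Open i; Close i.+1] [::].
Proof.
apply: reduces_same => // [n|s] /=; case: ifP => //=; rewrite !ltnS.
  by case: ifP.
by move=> _; case: ifP => // lt_i _; apply: trace_zigzag_right.
Qed.

Lemma reduces_zigzag_left i : reduces 0 [:: Open i.+1; Close i] [::].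
Proof.
apply: reduces_same => // [n|s] /=; case: ifP => //= lt_i; rewrite !ltnS.
  by case: ifP.
move=> _; rewrite [trace_step _ _]trace_zigzag_left //.
exact: same_joins_refl.
Qed.

Lemma reduces_far_left j d :
  reduces 0 [:: Open (j + d.+2); Close j] [:: Close j; Open (j + d)].
Proof.
apply: reduces_same => // [n|s] /=; case: ifP => //= le_j; case: ifP => //= _ _.
  have -> : (j.+1 < n)%N by lia.
  case: n le_j => [|[|n]] /=; first by lia.
    by lia.
  by rewrite !addnS !ltnS => ->.
exact: trace_far_left.
Qed.

Lemma reduces_far_right i d :
  reduces 0 [:: Open i; Close (i + d.+2)] [:: Close (i + d); Open i].
Proof.
apply: reduces_same => // [n|s] /=; case: ifP => //= le_i;
  case: ifP => //= lt_d _.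
  have -> : ((i + d).+1 < n)%N by lia.
  case: n le_i lt_d => [|[|n]] /=; first by lia.
    by lia.
  by move=> _ lt_d; have -> : (i <= n)%N by lia.
by apply: trace_far_right; lia.
Qed.

Arguments reduces_circle : clear implicits.
Arguments reduces_zigzag_left : clear implicits.
Arguments reduces_zigzag_right : clear implicits.
Arguments reduces_far_left : clear implicits.
Arguments reduces_far_right : clear implicits.

(** A maximum slides down through a row of minima until it forms a circle or a
zigzag with one of them and disappears, or until it has passed them all.  The
shift [k] is universally quantified last, so that a single reduction serves for
all horizontal positions of the diagram. *)
Lemma reduce_open_closes i (C : seq nat) : exists c C' O, forall k,
  reduces c (map (shift_piece k) (Open i :: map Close C))
            (map (shift_piece k) (map Close C' ++ map Open O)).
Proof.
elim: C i => [|j C IHC] i.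
  by exists 0%N, [::], [:: i] => k; apply: reduces_refl.
(* |i - j| is 0 for a circle, 1 for a zigzag, and larger otherwise. *)
case: (ltngtP i j) => [lt_ij | lt_ji | ->]; last first.
- exists 1%N, C, [::] => k; rewrite cats0.
  exact: (reduces_catr (map (shift_piece k) (map Close C))
    (reduces_circle (k + j)%N)).
- have [lt_j1i|] := ltnP j.+1 i; last first.
    move=> le_i; have -> : i = j.+1 by lia.
    exists 0%N, C, [::] => k; rewrite cats0 /= addnS.
    exact: (reduces_catr (map (shift_piece k) (map Close C))
    (reduces_zigzag_left (k + j)%N)).
  have [c [C' [O r]]] := IHC i.-2; exists c, (j :: C'), O => k.
  have [e def_i] : exists e, i = (j + e.+2)%N by exists (i - j.+2)%N; lia.
  apply: (@reduces_trans 0 c); last exact: reduces_cons (r k).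
  rewrite /= def_i !addnS /= addnA -!addnS.
  exact: (reduces_catr (map (shift_piece k) (map Close C))
    (reduces_far_left (k + j)%N e)).
have [lt_i1j|] := ltnP i.+1 j; last first.
  move=> le_j; have -> : j = i.+1 by lia.
  exists 0%N, C, [::] => k; rewrite cats0 /= addnS.
  exact: (reduces_catr (map (shift_piece k) (map Close C))
    (reduces_zigzag_right (k + i)%N)).
have [c [C' [O r]]] := IHC i; exists c, (j.-2 :: C'), O => k.
have [e def_j] : exists e, j = (i + e.+2)%N by exists (j - i.+2)%N; lia.
apply: (@reduces_trans 0 c); last exact: reduces_cons (r k).
rewrite /= def_j !addnS /= addnA -!addnS.
exact: (reduces_catr (map (shift_piece k) (map Close C))
    (reduces_far_right (k + i)%N e)).
Qed.

Lemma reduce_closes_opens w : all crossingless w -> exists c C O, forall k,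
  reduces c (map (shift_piece k) w)
            (map (shift_piece k) (map Close C ++ map Open O)).
Proof.
elim: w => [_|p w IHw /= /andP[nc_p /IHw[c [C [O r]]]]].
  by exists 0%N, [::], [::] => k; apply: reduces_refl.
case: p nc_p => [i|i|] // _; last first.
  by exists c, (i :: C), O => k; apply: reduces_cons.
have [c' [C' [O' r']]] := reduce_open_closes i C.
exists (c + c')%N, C', (O' ++ O) => k.
apply: reduces_trans; first exact: (@reduces_cons c (Open (k + i)%N)).
have := reduces_catr (map (shift_piece k) (map Open O)) (r' k).
by rewrite -!map_cat -catA -(map_cat Open).
Qed.

Lemma width_opens n (O : seq nat) m :
  width n (map Open O) = Some m -> m = (n + (size O).*2)%N.
Proof.
elim: O n => [|i O IHO] n /=; first by case; rewrite addn0.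
by case: ifP => //= _ /IHO->; lia.
Qed.

Lemma map_shift0 w : map (shift_piece 0) w = w.
Proof. by rewrite -[RHS]map_id; apply: eq_map => -[]. Qed.

(** Minima use up strands from the top: with two strands there, there is either
no minimum, and then no maximum either, or one minimum, and then one maximum. *)
Lemma reduce_tangle w : all crossingless w -> width 2 w = Some 2 ->
  exists c N, (N = [::] \/ N = zero_pieces) /\
    forall k, reduces c (map (shift_piece k) w) (map (shift_piece k) N).
Proof.
move=> nc_w ok_w; have [c [C [O r]]] := reduce_closes_opens nc_w.
exists c, (map Close C ++ map Open O); split=> //.
have [] := r 0%N trace_start; rewrite !map_shift0 /= ok_w // => + _.
case: C {r} => [|j C] /=.
  by move/width_opens; case: O => [_|i O] /=; [left | lia].
case: j => [|j] //=; case: C => [|j' C] //= ok_O; right.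
case: O ok_O => [|i O] //=; case: i => //= /width_opens.
by case: O => //= i O; lia.
Qed.

(** The replacement principle.  The prefix [u] holds the part whose crossings
are already smoothed, as in [bracket_rec], so that the induction follows the
recursion defining the coefficients.  For a crossingless diagram, the same
reduction is used twice: at the position [k] under the state [s], and for the
diagram alone, where it evaluates the coefficients. *)
Lemma bracket_from_tangle u w s k v :
    all crossingless u -> width 2 (u ++ w) = Some 2 ->
    (k.+1 < size (front s))%N -> width (size (front s)) v ->
  bracket_from s (map (shift_piece k) (u ++ w) ++ v) =
  bracket_rec u w 0 0 *: bracket_from s (map (shift_piece k) zero_pieces ++ v)
  + bracket_rec u w 1 0 *: bracket_from s v.
Proof.
move=> nc_u ok_uw lt_k ok_v.
have nc_shift x :
    all crossingless x -> all crossingless (map (shift_piece k) x).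
  by rewrite all_map => /sub_all; apply=> -[].
elim: w u nc_u ok_uw => [|p w IHw] u nc_u; last first.
  case: p => [i|i|b i] ok_uw.
  - by rewrite -cat_rcons IHw ?cat_rcons // all_rcons.
  - by rewrite -cat_rcons IHw ?cat_rcons // all_rcons.
  have ok_w : width 2 (u ++ w) = Some 2.
    by rewrite (@width_remove _ _ b i) ok_uw.
  rewrite -width_smooth in ok_uw.
  have -> : bracket_from s (map (shift_piece k) (u ++ Cross b i :: w) ++ v) =
      tpow (if b then 1 else -1) *:
        bracket_from s
          (map (shift_piece k) ((u ++ [:: Close i; Open i]) ++ w) ++ v)
      + tpow (if b then -1 else 1) *:
        bracket_from s (map (shift_piece k) (u ++ w) ++ v).
    rewrite !map_cat -!catA !(bracket_from_cat _ _ (nc_shift _ nc_u)).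
    by [].
  rewrite !IHw ?all_cat ?nc_u -?catA //= !mxE !scalerDr !scalerDl !scalerA.
  by rewrite addrACA.
rewrite cats0 => ok_u /=.
have [c [N [defN r]]] := reduce_tangle nc_u ok_u.
have size_s : width (size (front s)) (map (shift_piece k) u) =
              Some (size (front s)).
  have -> : size (front s) = (k + 2 + (size (front s) - (k + 2)))%N by lia.
  exact/width_widen/width_shift.
have [] := r k s; rewrite size_s // => _ -> //; last first.
  by rewrite width_cat size_s.
have -> : crossingless_bracket u = bracket_from trace_start u.
  by rewrite -[u in RHS]cats0 bracket_from_cat.
have [] := r 0%N trace_start; rewrite !map_shift0 /= ok_u // => _ /(_ [::]).
rewrite !cats0 => -> //; last by rewrite /= ok_u.
case: defN => ->; rewrite /= expr0 scale1r /bracket_zero /bracket_infty !mxE /=.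
  by rewrite mulr0 mulr1 scale0r add0r.
by rewrite mulr0 mulr1 scale0r addr0.
Qed.

End BracketFrom.

(** * Brackets of sums of tangles *)

Definition has_bracket (T : tangle) (a b : laurent) :=
  bracket_f T = a /\ bracket_g T = b.

Lemma has_bracketP T a b :
  bracket_pair T = a *: bracket_zero + b *: bracket_infty -> has_bracket T a b.
Proof.
move=> pairT; rewrite /has_bracket /bracket_f /bracket_g pairT.
by rewrite !mxE /= !mulr1 !mulr0 addr0 add0r.
Qed.

Lemma bracket_from_context (T : tangle) a b s k v : has_bracket T a b ->
    (k.+1 < size (front s))%N -> width (size (front s)) v ->
  bracket_from s (map (shift_piece k) T ++ v) =
  a *: bracket_from s (map (shift_piece k) zero_pieces ++ v)
  + b *: bracket_from s v.
Proof.
case=> <- <- lt_k ok_v; apply: (@bracket_from_tangle [::]) => //.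
exact/eqP/tangle_width.
Qed.

(** Of the four diagrams made of 0 and infinity, only 0 above 0 closes up a
circle. *)
Lemma bracket_vsum T1 T2 f1 g1 f2 g2 :
  has_bracket T1 f1 g1 -> has_bracket T2 f2 g2 ->
  has_bracket (vsum T1 T2) (f1 * g2 + g1 * f2 + delta * (f1 * f2)) (g1 * g2).
Proof.
move=> br1 br2; apply: has_bracketP.
have T2_cat : T2 = map (shift_piece 0) T2 ++ [::] :> seq piece.
  by rewrite map_shift0 cats0.
rewrite /bracket_pair bracket_recE.
rewrite -[vsum _ _ : seq _]/(T1 ++ T2) -(map_shift0 T1).
rewrite (bracket_from_context br1) //; last by rewrite (eqP (tangle_width T2)).
rewrite bracket_from_cat // T2_cat !(bracket_from_context br2) //=.
rewrite expr0 expr1 !scale1r !scalerDr !scalerA !scalerDl.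
by rewrite (mulrC delta) addrA; congr (_ + _); rewrite -addrA addrC.
Qed.

(** Here the circle arises from infinity beside infinity. *)
Lemma bracket_hsum T1 T2 f1 g1 f2 g2 :
  has_bracket T1 f1 g1 -> has_bracket T2 f2 g2 ->
  has_bracket (hsum T1 T2) (f1 * f2) (f1 * g2 + g1 * f2 + delta * (g1 * g2)).
Proof.
move=> br1 br2; apply: has_bracketP.
rewrite /bracket_pair bracket_recE.
have -> : bracket_from (foldl trace_step trace_start [::]) (hsum T1 T2) =
  bracket_from (trace_step trace_start (Open 1))
    (map (shift_piece 0) T1 ++ map (shift_piece 2) T2 ++ [:: Close 1]).
  by rewrite map_shift0.
have ok2 : width 4 (map (shift_piece 2) T2) = Some 4.
  exact: (width_shift 2 (eqP (tangle_width T2))).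
rewrite (bracket_from_context br1) //; last by rewrite width_cat ok2.
rewrite bracket_from_cat // !(bracket_from_context br2) //=.
rewrite expr0 expr1 !scale1r !scalerDr !scalerA !scalerDl.
by rewrite (mulrC delta) !addrA.
Qed.

(** * The brackets of T10 and T20 *)

(** Lets one computation serve a tangle and its mirror image. *)
Definition signed (b : bool) T := if b then T else switch T.

Lemma tangle_eq (T1 T2 : tangle) : T1 = T2 :> seq piece -> T1 = T2.
Proof.
case: T1 T2 => [w1 ok1] [w2 ok2] /= eq_w; case: w2 / eq_w ok2 => ok2.
by rewrite (eq_irrelevance ok1 ok2).
Qed.

Lemma signed_vsum b T1 T2 :
  signed b (vsum T1 T2) = vsum (signed b T1) (signed b T2).
Proof. by case: b => //; apply: tangle_eq; rewrite /= map_cat. Qed.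

Lemma signed_hsum b T1 T2 :
  signed b (hsum T1 T2) = hsum (signed b T1) (signed b T2).
Proof.
case: b => //; apply: tangle_eq; rewrite /= /hsum_pieces !map_cat /=.
by rewrite -!map_comp; congr (_ :: _ ++ _ ++ _); apply: eq_map => -[].
Qed.

(** Indexed so that switching crossings amounts to negating [b]. *)
Definition skein_unit (b : bool) : laurent := tpow (if b then 1 else -1).

Lemma skein_unitM b : skein_unit b * skein_unit (~~ b) = 1.
Proof. by case: b; rewrite tpowD ?subrr ?addNr. Qed.

Lemma deltaE b : delta = - (skein_unit b ^+ 2 + skein_unit (~~ b) ^+ 2).
Proof.
have sq (n : int) : tpow n ^+ 2 = tpow (n * 2).
  by rewrite expr2 tpowD mulr_natr mulr2n.
case: b; rewrite /delta /skein_unit !sq mulN1r mul1r [RHS]opprD //.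
by rewrite [LHS]addrC.
Qed.

Lemma bracket_cross b :
  has_bracket (signed b tangle_one) (skein_unit b) (skein_unit (~~ b)).
Proof.
apply: has_bracketP; rewrite /bracket_pair.
by case: b; rewrite /= /crossingless_bracket /= !expr0 !scale1r.
Qed.

Lemma tangle_moneE b : signed b tangle_mone = signed (~~ b) tangle_one.
Proof. by case: b => //; apply: tangle_eq. Qed.

Lemma has_bracket_eq T f g f' g' :
  has_bracket T f g -> f = f' -> g = g' -> has_bracket T f' g'.
Proof. by move=> br <- <-. Qed.

(** Follows the definition of T10 sum by sum; with t and u as two variables, the
identities between Laurent polynomials hold modulo t u = 1. *)
Lemma bracket_T10 b (t := skein_unit b) (u := skein_unit (~~ b)) :
  has_bracket (signed b T10)
    (t ^+ 18 - 2 * t ^+ 14 + 2 * t ^+ 10 - 2 * t ^+ 6 + 2 * u ^+ 2 - 2 * u ^+ 6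
       + 2 * u ^+ 10)
    (t ^+ 16 - 3 * t ^+ 12 + 5 * t ^+ 8 - 7 * t ^+ 4 + 7 - 5 * u ^+ 4
       + 2 * u ^+ 8).
Proof.
have tu : t * u = 1 := skein_unitM b.
have dE : delta = - (t ^+ 2 + u ^+ 2) := deltaE b.
have one := bracket_cross b; rewrite -/t -/u in one.
have mone := bracket_cross (~~ b); rewrite -tangle_moneE negbK -/t -/u in mone.
have half : has_bracket (signed b (tangle_inv 2)) (1 - t ^+ 4) (u ^+ 2).
  rewrite /tangle_inv /= signed_vsum.
  by apply: has_bracket_eq (bracket_vsum one one) _ _; rewrite ?dE; ring: tu.
have two : has_bracket (signed b (tangle_pos 2)) (t ^+ 2) (1 - u ^+ 4).
  rewrite /tangle_pos /= signed_hsum.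
  by apply: has_bracket_eq (bracket_hsum one one) _ _; rewrite ?dE; ring: tu.
have mthree : has_bracket (signed b (tangle_neg 3))
    (u ^+ 3) (t ^+ 7 - t ^+ 3 + u).
  rewrite /tangle_neg /= !signed_hsum.
  by apply: has_bracket_eq (bracket_hsum mone (bracket_hsum mone mone)) _ _;
    rewrite ?dE; ring: tu.
have h1 : has_bracket (signed b (hsum (tangle_inv 2) tangle_one))
    (t - t ^+ 5) (- t ^+ 3 + u - u ^+ 5).
  rewrite signed_hsum.
  by apply: has_bracket_eq (bracket_hsum half one) _ _; rewrite ?dE; ring: tu.
have h2 : has_bracket
    (signed b (vsum (hsum (tangle_inv 2) tangle_one) (tangle_pos 2)))
    (t ^+ 9 - 2 * t ^+ 5 + 2 * t - 2 * u ^+ 3)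
    (- t ^+ 3 + 2 * u - 2 * u ^+ 5 + u ^+ 9).
  rewrite signed_vsum.
  by apply: has_bracket_eq (bracket_vsum h1 two) _ _; rewrite ?dE; ring: tu.
have h3 : has_bracket (signed b (hsum
      (vsum (hsum (tangle_inv 2) tangle_one) (tangle_pos 2)) (tangle_neg 3)))
    (t ^+ 6 - 2 * t ^+ 2 + 2 * u ^+ 2 - 2 * u ^+ 6)
    (t ^+ 16 - 2 * t ^+ 12 + 3 * t ^+ 8 - 4 * t ^+ 4 + 3 - 2 * u ^+ 4).
  rewrite signed_hsum.
  by apply: has_bracket_eq (bracket_hsum h2 mthree) _ _; rewrite ?dE; ring: tu.
rewrite signed_vsum.
by apply: has_bracket_eq (bracket_vsum h3 two) _ _; rewrite ?dE; ring: tu.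
Qed.

Definition laurent_sum (s : seq (int * int)) : laurent :=
  \sum_(p <- s) tpow p.2 *~ p.1.

Lemma coef_laurent_sum s n :
  (laurent_sum s)@_n = \sum_(p <- s | p.2 == n) p.1.
Proof.
rewrite /laurent_sum raddf_sum [RHS]big_mkcond; apply: eq_bigr => p _ /=.
by rewrite raddfMz /= mcoeffU; case: eqP => _; rewrite ?mul0rz // intz.
Qed.

Lemma leading_term_laurent_sum c n s : c != 0 ->
  all (fun p => p.2 < n) s -> leading_term (laurent_sum ((c, n) :: s)) c n.
Proof.
move=> c0 /allP lt_s; have coef k : n <= k ->
    (laurent_sum ((c, n) :: s))@_k = if n == k then c else 0.
  move=> le_nk; rewrite coef_laurent_sum big_cons /= big1_seq ?addr0 //.
  by move=> p /andP[/eqP p_k /lt_s]; rewrite p_k; lia.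
split=> // [|k lt_nk]; first by rewrite coef ?eqxx.
by rewrite coef ?ltW // lt_eqF.
Qed.

Lemma leading_term_mulrnD (f h : laurent) c n m : leading_term h c n ->
  (forall k, n <= k -> f@_k = 0) -> leading_term (h *+ m.+1 + f) (c *+ m.+1) n.
Proof.
case=> c0 hc hk fk; split=> [||k lt_nk].
- by rewrite mulrn_eq0.
- by rewrite mcoeffD mcoeffMn hc fk ?addr0.
by rewrite mcoeffD mcoeffMn hk // fk ?ltW // mul0rn addr0.
Qed.

Lemma tpow0 : tpow 0 = 1.
Proof. by []. Qed.

Lemma tpow_nat (n : nat) : tpow n%:R = skein_unit true ^+ n.
Proof. by elim: n => // n IHn; rewrite exprSr -IHn tpowD natr1. Qed.

Lemma tpow_opp_nat (n : nat) : tpow (- n%:R) = skein_unit false ^+ n.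
Proof.
by elim: n => [|n IHn]; rewrite ?oppr0 // exprSr -IHn tpowD -opprD natr1.
Qed.

(** Half of f (T20) - 1 and half of g (T20), as lists of a coefficient and an
exponent, with the leading term first. *)
Definition half_f := [:: (1, 28); (- 3, 24); (5, 20); (- 6, 16); (3, 12);
  (3, 8); (- 9, 4); (12, 0); (- 9, - 4); (3, - 8); (3, - 12); (- 6, - 16);
  (5, - 20); (- 3, - 24); (1, - 28)] : seq (int * int).

Definition half_g := [:: (1, 26); (- 4, 22); (9, 18); (- 15, 14); (18, 10);
  (- 15, 6); (6, 2); (6, - 2); (- 15, - 6); (18, - 10); (- 15, - 14);
  (9, - 18); (- 4, - 22); (1, - 26)] : seq (int * int).

(** The sum of T10 and its mirror image.  Modulo 2, f (T10) is t ^ 18 and the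
mirror image contributes t ^ -18, which is why f (T20) is odd only in degree
0. *)
Lemma bracket_T20 :
  has_bracket T20 (laurent_sum half_f *+ 2 + 1) (laurent_sum half_g *+ 2).
Proof.
have br := bracket_hsum (bracket_T10 true) (bracket_T10 false).
have tu := skein_unitM true.
by apply: has_bracket_eq br _ _; rewrite ?(deltaE true) /laurent_sum !big_cons
  big_nil /= ?tpow_nat ?tpow_opp_nat ?tpow0; ring: tu.
Qed.

Theorem lemma4p2 :
  [/\ congr_mod 2 (bracket_f T20) 1 /\ congr_mod 2 (bracket_g T20) 0,
      leading_term (bracket_f T20) 2 28
    & leading_term (bracket_g T20) 2 26].
Proof.
have [-> ->] := bracket_T20; split.
- split; first by exists (laurent_sum half_f); rewrite addrK.
  by exists (laurent_sum half_g); rewrite subr0.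
- apply: (@leading_term_mulrnD 1 _ 1 28 1).
    exact: leading_term_laurent_sum.
  by move=> k le_k; rewrite mcoeffU lt_eqF // (lt_le_trans _ le_k).
rewrite -[_ *+ 2]addr0; apply: (@leading_term_mulrnD 0 _ 1 26 1).
  exact: leading_term_laurent_sum.
by move=> k _; rewrite mcoeff0.
Qed.
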